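(* Let $\ell:\mathbb{R}\times\mathbb{R}\to\mathbb{R}$ be twice differentiable and strictly convex in its second argument. Let the regularizer have the form $r(\boldsymbol\beta)=\sum_{k=0}^K r_k(\mathbf{A}_k\boldsymbol\beta+\mathbf{c}_k)$ for some $\mathbf{A}_k\in\mathbb{R}^{q_k\times p}$, $\mathbf{c}_k\in\mathbb{R}^{q_k}$, and convex $r_k:\mathbb{R}^{q_k}\to\mathbb{R}$. Let $\mathbf{X}\in\mathbb{R}^{n\times p}$ have rows $\mathbf{x}_i^\top$, let $\mathbf{y}\in\mathbb{R}^n$, let $\widehat{\boldsymbol\beta}$ solve $$\widehat{\boldsymbol\beta}=\arg\min_{\boldsymbol\beta\in\mathbb{R}^p}\ \sum_{i=1}^n \ell(y_i,\mathbf{x}_i^\top\boldsymbol\beta)+r(\boldsymbol\beta),$$ and let $\widehat{\mathbf{y}}=\mathbf{X}\widehat{\boldsymbol\beta}$. Suppose that: (i) $r_0$ is twice differentiable everywhere; (ii) for all $k\in\{1,\dots,K\}$, $r_k$ is twice differentiable everywhere except at $\mathbf{0}$; (iii) the set $\mathcal{S}=\{0\}\cup\{k\in\{1,\dots,K\}:\mathbf{A}_k\widehat{\boldsymbol\beta}+\mathbf{c}_k\neq\mathbf{0}\}$, viewed as a function of the label vector through $\widehat{\boldsymbol\beta}$, is constant in a neighborhood of $\mathbf{y}$. Let $\mathbf{H}_\ell=\mathrm{diag}\big((\ell''(y_i,\hat y_i))_{i=1}^n\big)$. Then for any vector $\mathbf{z}\in\mathbb{R}^n$, if there is a unique solution $\mathbf{v}^*\in\mathbb{R}^p$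 to the quadratic program $$\begin{array}{ll}\text{minimize}_{\mathbf{v}} & \frac12\mathbf{v}^\top\Big(\mathbf{X}^\top\mathbf{H}_\ell\mathbf{X}+\sum_{k\in\mathcal{S}}\mathbf{A}_k^\top\nabla^2 r_k(\mathbf{A}_k\widehat{\boldsymbol\beta}+\mathbf{c}_k)\mathbf{A}_k\Big)\mathbf{v}-\mathbf{v}^\top\mathbf{X}^\top\mathbf{H}_\ell\mathbf{z}\\ \text{subject to} & \mathbf{A}_k\mathbf{v}=\mathbf{0},\quad k\notin\mathcal{S},\end{array}$$ then $\widetilde{\mathbf{J}}\mathbf{z}=\mathbf{X}\mathbf{v}^*$, where $\widetilde{\mathbf{J}}$ is the normalized Jacobian of the predictions at $\mathbf{y}$.
   Context: Notation: $\ell'(y,z)=\partial\ell(y,z)/\partial z$ and $\ell''(y,z)=\partial^2\ell(y,z)/\partial z^2$. With $\mathbf{X}$ fixed, $\widehat{\boldsymbol\beta}$ and $\widehat{\mathbf{y}}=\mathbf{X}\widehat{\boldsymbol\beta}$ are regarded as functions of the label vector $\mathbf{y}$. $\mathbf{J}=\partial\widehat{\mathbf{y}}/\partial\mathbf{y}\in\mathbb{R}^{n\times n}$ is the Jacobian of this map at $\mathbf{y}$. The normalized Jacobian $\widetilde{\mathbf{J}}\in\mathbb{R}^{n\times n}$ is defined by $$\widetilde{J}_{ij}=-J_{ij}\,\frac{\ell''(y_j,\hat y_j)}{\partial\ell'(y_j,\hat y_j)/\partial y_j},$$ where $\partial\ell'(y_j,\hat y_j)/\partial y_j$ is the partial derivative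 of $\ell'$ in its first argument, evaluated at $(y_j,\hat y_j)$ and taken to be nonzero for every $j$. *)

(* Defs.v *)
From HB Require Import structures.
From mathcomp Require Export all_boot all_order all_algebra.
From mathcomp Require Export all_classical all_reals all_analysis.
Export Order.TTheory GRing.Theory Num.Theory.
Export numFieldNormedType.Exports.

#[export] Set Implicit Arguments.
#[export] Unset Strict Implicit.
#[export] Unset Printing Implicit Defensive.

Local Open Scope classical_set_scope.
Local Open Scope ring_scope.

(* Vectors are columns throughout; a column is read off at row i by v i 0. *)

Section Calculus.
Context {R : realType}.

(* Frechet sense. In finite dimension (the only case used), differentiability
   of x |-> 'd f x is the same as that of every x |-> 'd f x v = 'D_v f x. *)
Definition twice_differentiable (V : normedModType R) (f : V -> R) (a : V) :=
  (\forall x \near a, differentiable f x) /\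
  (forall v : V, differentiable ('D_v f) a).

Definition strictly_convex (f : R -> R) :=
  forall (t x y : R), 0 < t < 1 -> x != y ->
    f (t * x + (1 - t) * y) < t * f x + (1 - t) * f y.

Definition hessian (q : nat) (f : 'cV[R]_q -> R) (a : 'cV[R]_q) : 'M[R]_q :=
  \matrix_(i, j) 'D_(delta_mx i 0) ('D_(delta_mx j 0) f) a.

(* Entry (i, j) is the j-th partial derivative of the i-th component; the
   library's 'J f p is for row vectors and follows the transposed convention. *)
Definition col_jacobian (n m : nat) (f : 'cV[R]_n -> 'cV[R]_m)
    (a : 'cV[R]_n) : 'M[R]_(m, n) :=
  \matrix_(i, j) ('D_(delta_mx j 0) f a) i 0.

Definition minimizer (T : Type) (D : set T) (f : T -> R) (x : T) :=
  D x /\ forall x', D x' -> f x <= f x'.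

End Calculus.

Section Loss.
Context {R : realType}.
Variable l : R -> R -> R.

Definition loss1 (y z : R) : R := derive1 (l y) z.

Definition loss2 (y z : R) : R := derive1 (loss1 y) z.

Definition dloss1_dy (y z : R) : R := derive1 (loss1 ^~ z) y.

Definition normalized_jacobian (n : nat) (yhat : 'cV[R]_n -> 'cV[R]_n)
    (y : 'cV[R]_n) : 'M[R]_n :=
  \matrix_(i, j) (- col_jacobian yhat y i j *
    (loss2 (y j 0) (yhat y j 0) / dloss1_dy (y j 0) (yhat y j 0))).

Definition loss_hessian (n : nat) (y yhat : 'cV[R]_n) : 'M[R]_n :=
  diag_mx (\row_i loss2 (y i 0) (yhat i 0)).

End Loss.

Section Regularized.
Context {R : realType} (n p K : nat).
Variables (l : R -> R -> R) (X : 'M[R]_(n, p)).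
Variables (q : 'I_K.+1 -> nat) (A : forall k, 'M[R]_(q k, p)).
Variables (c : forall k, 'cV[R]_(q k)) (r : forall k, 'cV[R]_(q k) -> R).

Definition erm_objective (y : 'cV[R]_n) (b : 'cV[R]_p) : R :=
  \sum_(i < n) l (y i 0) ((X *m b) i 0) +
  \sum_(k < K.+1) r (A k *m b + c k).

Definition active_set (b : 'cV[R]_p) : {set 'I_K.+1} :=
  [set k | (k == ord0) || (A k *m b + c k != 0)]%SET.

Definition qp_matrix (y : 'cV[R]_n) (b : 'cV[R]_p) : 'M[R]_p :=
  X^T *m loss_hessian l y (X *m b) *m X +
  \sum_(k in active_set b)
     (A k)^T *m hessian (@r k) (A k *m b + c k) *m A k.

Definition qp_objective (y : 'cV[R]_n) (b : 'cV[R]_p) (z : 'cV[R]_n)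
    (v : 'cV[R]_p) : R :=
  2^-1 * (v^T *m qp_matrix y b *m v) 0 0 -
  (v^T *m X^T *m loss_hessian l y (X *m b) *m z) 0 0.

Definition qp_feasible (b : 'cV[R]_p) : set 'cV[R]_p :=
  [set v | forall k, k \notin active_set b -> A k *m v = 0].

End Regularized.

(* Main.v *)
From HB Require Import structures.
Require Import Defs.
From mathcomp Require Import ring lra.

Local Open Scope classical_set_scope.
Local Open Scope ring_scope.

(** The predictions are obtained by implicit differentiation of the stationarity
condition, on the affine space that the active set cuts out.

Let b = bhat y and let W be the common kernel of the A k with k outside the
active set. For labels near y the active set does not change, so the solution
stays in b + W, where the inactive penalties are constant and the active ones
are twice differentiable at b. In coordinates w of W ([common_kernel_basis]) the
problem becomes an unconstrained convex one whose gradient G (y', w) is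
differentiable at (y, 0), with derivative B h + M u ([is_diff_reduced_gradient]):
M is the matrix of the quadratic program compressed to W, and B collects the
mixed derivatives of the loss in label and prediction. That the derivative of
the gradients of the penalties is given by symmetric Hessians is the classical
symmetry of second derivatives ([derive_comm]).

A unique solution of the quadratic program forces M to be positive definite
([quad_unique_minimizer]), hence invertible and coercive. The usual implicit
function theorem does not apply, because second derivatives need not be
continuous and no continuity of bhat is given. Convexity replaces both: at
points of W whose distance to 0 is a large multiple of |y' - y|, the coercivity
of M makes the objective increase away from 0, which confines the minimizer to a
ball of radius C |y' - y| ([minimizer_lipschitz]). Linearizing G (y', w y') = 0
then shows that w is differentiable at y with derivative h |-> - M^-1 B h
([is_diff_minimizer]).

The normalization of the Jacobian is exactly what turns B h into - N^T X^T H z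
([diag_mul_quotient]), so the Jacobian yields X N M^-1 N^T X^T H z, and
N M^-1 N^T X^T H z is the solution of the quadratic program. *)

(** * Calculus for column vectors *)

Section FiniteDim.
Context {R : realType}.

Lemma linear_mx_continuous (m n : nat) (W : normedModType R)
  (f : {linear 'M[R]_(m, n) -> W}) : continuous f.
Proof.
have -> : (f : _ -> _) =
    (fun M : 'M[R]_(m, n) => \sum_i \sum_j M i j *: f (delta_mx i j)).
  apply/funext => M; rewrite {1}(matrix_sum_delta M) linear_sum.
  by apply: eq_bigr => i _; rewrite linear_sum; apply: eq_bigr => j _; rewrite linearZ.
apply: continuous_big => [|i _]; first exact: add_continuous.
apply: continuous_big => [|j _]; first exact: add_continuous.
by move=> M; apply: continuousZr_tmp; exact: coord_continuous.
Qed.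

Lemma is_diff_mulmx (V : normedModType R) (m n p : nat) (M : 'M[R]_(m, n))
    (f df : V -> 'M[R]_(n, p)) x :
  is_diff x f df -> is_diff x (fun t => M *m f t) (fun t => M *m df t).
Proof.
move=> dfx.
have Mc : continuous (mulmx M : 'M[R]_(n, p) -> 'M[R]_(m, p)).
  exact: linear_mx_continuous.
have dM : is_diff (f x) (mulmx M : 'M[R]_(n, p) -> _) (mulmx M).
  by apply: DiffDef; [exact: linear_differentiable|exact: diff_lin].
exact: is_diff_comp.
Qed.

Lemma is_diff_col (V : normedModType R) (m : nat)
    (f df : 'I_m -> V -> R) x :
  (forall i, is_diff x (f i) (df i)) ->
  is_diff x (fun t => \col_i f i t) (fun t => \col_i df i t).
Proof.
move=> dfx.
have E (g : 'I_m -> V -> R) : (fun t => \col_i g i t) =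
    \sum_i (fun t => g i t *: (delta_mx i 0 : 'cV[R]_m)).
  apply/funext => t; rewrite fct_sumE; apply/colP => i.
  rewrite summxE (bigD1 i)//= big1 ?addr0 => [|j ji]; rewrite !mxE.
    by rewrite !eqxx mulr1.
  by rewrite eq_sym (negPf ji) mulr0.
rewrite !E; elim/big_ind2 : _ => [|f1 g1 f2 g2|i _].
- exact: is_diff_cst.
- exact: is_diffD.
- apply: (@is_diff_comp _ _ _ _ (f i) (df i) ( *:%R ^~ (delta_mx i 0 : 'cV[R]_m))
    ( *:%R ^~ (delta_mx i 0 : 'cV[R]_m)) x).
Qed.

(** This lemma and the next one trade the little-o in differentiability for
epsilon estimates, the form in which the minimizer is controlled below. *)
Lemma is_diff_norm_le (V W : normedModType R) (f df : V -> W) a :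
  is_diff a f df -> forall e : R, 0 < e ->
  \forall t \near a, `|f t - f a - df (t - a)| <= e * `|t - a|.
Proof.
move=> dfa e e0.
have df' : differentiable f a by exact: ex_diff.
have /eqaddoP H0 := diff_locally df'.
have := H0 e e0; rewrite diff_val => {H0} H.
have {H} : \forall t \near (0 : V), `|f (t + a) - f a - df t| <= e * `|t|.
  apply: filterS H => t; congr (`|_| <= _).
  by rewrite /= -addrA -opprD.
move=> /nbhs_norm0P[d d0 H]; apply/nbhs_normP; exists d => //= t ta.
have := H (t - a); rewrite subrK; apply.
by rewrite /= distrC.
Qed.

Lemma norm_le_is_diff (V W : normedModType R) (f : V -> W) (df : {linear V -> W}) a :
  continuous df ->
  (forall e : R, 0 < e ->
   \forall t \near a, `|f t - f a - df (t - a)| <= e * `|t - a|) ->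
  is_diff a f df.
Proof.
move=> dfc H.
have E : f \o shift a = cst (f a) + df +o_ 0 id.
  apply/eqaddoP => e e0; have /nbhs_normP[d d0 {}H] := H e e0.
  apply/nbhs_norm0P; exists d => //= t td.
  have := H (t + a); rewrite /= opprD addrCA subrr addr0 normrN => /(_ td).
  by rewrite addrK -addrA -opprD.
have dE := diff_unique dfc E.
by apply: DiffDef => //; apply/diff_locallyP; rewrite dE; split.
Qed.

Lemma normv_coord (n : nat) (x : 'cV[R]_n) i : `|x i 0| <= `|x|.
Proof.
rewrite [leRHS]/Num.Def.normr/= mx_normrE.
exact: (@le_bigmax _ _ _ _ (fun ij : 'I_n * 'I_1 => `|x ij.1 ij.2|) (i, 0)).
Qed.

Lemma dot_norm_le (n : nat) (x y : 'cV[R]_n) :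
  `|(x^T *m y) 0 0| <= n%:R * `|x| * `|y|.
Proof.
rewrite mxE (le_trans (ler_norm_sum _ _ _))//.
have -> : n%:R * `|x| * `|y| = \sum_(i < n) `|x| * `|y|.
  by rewrite sumr_const card_ord -mulrA mulr_natl.
apply: ler_sum => i _; rewrite !mxE normrM.
by apply: ler_pM => //; exact: normv_coord.
Qed.

(** The quadratic form is homogeneous, so its minimum on the unit sphere, which
is attained by compactness and is positive, serves as the constant. *)
Lemma quad_coercive (d : nat) (M : 'M[R]_d) :
  (forall u : 'cV[R]_d, u != 0 -> 0 < (u^T *m M *m u) 0 0) ->
  exists2 m : R, 0 < m & forall u : 'cV[R]_d, m * `|u| ^+ 2 <= (u^T *m M *m u) 0 0.
Proof.
move=> Mpos.
pose f (u : 'rV[R]_d) : R := (u *m M *m u^T) 0 0.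
pose S := [set u : 'rV[R]_d | `|u| = 1].
have normT (u : 'cV[R]_d) : `|u^T| = `|u|.
  rewrite /Num.Def.normr/= !mx_normrE; apply/le_anti/andP; split; apply/bigmax_leP; split.
  - by elim/big_ind : _ => // x y x0 y0; rewrite le_max x0.
  - move=> [i j] _ /=; rewrite mxE.
    exact: (@le_bigmax _ _ _ _ (fun ij : 'I_d * 'I_1 => `|u ij.1 ij.2|) (j, i)).
  - by elim/big_ind : _ => // x y x0 y0; rewrite le_max x0.
  - move=> [i j] _ /=; have -> : u i j = u^T j i by rewrite mxE.
    exact: (@le_bigmax _ _ _ _ (fun ij : 'I_1 * 'I_d => `|u^T ij.1 ij.2|) (j, i)).
have [u0|] := pselect (S !=set0); last first.
  move=> S0; exists 1 => // u; suff -> : u = 0.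
    by rewrite normr0 expr0n mulr0 mulmx0 mxE.
  apply/eqP/negPn/negP => u0; apply: S0; exists (`|u|^-1 *: u^T).
  by rewrite /S/= normrZ normfV normr_id normT mulVf ?normr_eq0.
have Scomp : compact S.
  apply: bounded_closed_compact.
    by exists 1; split => // x x1 u /= ->; exact: ltW.
  rewrite /S (_ : [set _ | _] = Num.Def.normr @^-1` [set 1 : R])//.
  apply: closed_comp => [u _|]; last exact: closed_eq.
  exact: norm_continuous.
have fc : continuous f.
  have cT (A : 'M[R]_d) : continuous (fun u : 'rV[R]_d => u *m A).
    exact: (@linear_mx_continuous 1 d 'rV[R]_d (mulmxr A)).
  move=> u.
  have -> : f = \sum_i (fun u : 'rV[R]_d => (u *m M) 0 i * u 0 i).
    by apply/funext => v; rewrite fct_sumE /f mxE; apply: eq_bigr => i _; rewrite [v^T _ _]mxE.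
  move: u; elim/big_ind : _ => [u|g h cg ch u|i _ u].
  - exact: cst_continuous.
  - by apply: continuousD; [exact: cg|exact: ch].
  - apply: continuousM; last exact: coord_continuous.
    apply: (@continuous_comp _ _ _ (fun u : 'rV[R]_d => u *m M) (fun v : 'rV[R]_d => v 0 i)).
      exact: cT.
    exact: coord_continuous.
have [c] := EVT_min_rV u0 Scomp (continuous_subspaceT fc).
rewrite inE => Sc cmin.
exists (f c).
  have := Mpos c^T; rewrite trmxK; apply.
  apply: contraPN Sc => /eqP c0; rewrite /S/=.
  by rewrite -[c]trmxK c0 trmx0 normr0 => /eqP; rewrite eq_sym oner_eq0.
move=> u; have [->|u0'] := eqVneq u 0.
  by rewrite normr0 expr0n mulr0 mulmx0 mxE.
have nu0 : `|u| != 0 by rewrite normr_eq0.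
have := cmin (`|u|^-1 *: u^T); rewrite inE /S/=.
rewrite normrZ normfV normr_id normT mulVf// => /(_ erefl).
rewrite /f linearZ/= -!scalemxAl -!scalemxAr !mxE trmxK mulrA -invfM -expr2.
by rewrite mulrC ler_pdivlMr// exprn_gt0// lt_neqAle eq_sym nu0 normr_ge0.
Qed.

End FiniteDim.

(** * Symmetry of second derivatives *)

Section Young.
Context {R : realType} {V : normedModType R}.

Lemma is_derive_line (W : normedModType R) (f : V -> W) (b v : V) (t : R) :
  differentiable f (b + t *: v) ->
  is_derive t 1 (fun s => f (b + s *: v)) ('D_v f (b + t *: v)).
Proof.
move=> df.
have dl : is_diff t (fun s : R => b + s *: v) (fun s => s *: v).
  have := is_diffD (is_diff_cst b t) (is_diff_scalel t v).
  by rewrite add0r.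
have dc : is_diff t (f \o (fun s : R => b + s *: v))
    ('d f (b + t *: v) \o (fun s => s *: v)).
  apply: (@is_diff_comp _ _ _ _ _ _ _ _ _ dl); exact: differentiableP.
have -> : 'D_v f (b + t *: v) = 'D_1 (f \o (fun s : R => b + s *: v)) t.
  by rewrite !deriveE// diff_val /= scale1r.
by apply: DeriveDef => //; exact: diff_derivable.
Qed.

(** Applying the mean value theorem to t |-> f (a + s u + t v) - f (a + t v)
expresses the second difference through 'D_v f at two points near a, where the
differentiability of 'D_v f at a makes it linear up to an error o(s). *)
Lemma second_difference (f : V -> R) (a u v : V) : twice_differentiable f a ->
  forall e : R, 0 < e -> \forall s \near 0^'+,
  `|f (a + s *: u + s *: v) - f (a + s *: u) - f (a + s *: v) + f a
    - s ^+ 2 * 'D_u ('D_v f) a| <= e * s ^+ 2.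
Proof.
move=> [fa fv] e e0.
have /differentiableP/is_diff_norm_le gd := fv v.
(* For 0 <= t <= s, both a + s u + t v and a + t v are within s * c of a. *)
set c := `|u| + `|v| + 1.
have c0 : 0 < c by rewrite ltr_wpDl// addr_ge0.
have e'0 : 0 < e / (2 * c) by rewrite divr_gt0// mulr_gt0.
have /nbhs_normP[d /= d0 H] : \forall t \near a, differentiable f t /\
    `|'D_v f t - 'D_v f a - 'd ('D_v f) a (t - a)| <= e / (2 * c) * `|t - a|.
  near=> t; split; near: t => //; exact: gd.
near=> s.
have s0 : 0 < s by near: s; exact: nbhs_right_gt.
have sc : s * c < d.
  by rewrite -ltr_pdivlMr//; near: s; apply: nbhs_right_lt; rewrite divr_gt0.
have bnd (al be : R) : 0 <= al <= s -> 0 <= be <= s -> `|al *: u + be *: v| <= s * c.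
  move=> /andP[al0 als] /andP[be0 bes].
  rewrite (le_trans (ler_normD _ _))// !normrZ !ger0_norm// /c !mulrDr mulr1.
  have := ler_wpM2r (normr_ge0 u) als; have := ler_wpM2r (normr_ge0 v) bes.
  by lra.
have near_a (al be : R) : 0 <= al <= s -> 0 <= be <= s ->
    differentiable f (a + al *: u + be *: v) /\
    `|'D_v f (a + al *: u + be *: v) - 'D_v f a - 'd ('D_v f) a (al *: u + be *: v)|
      <= e / (2 * c) * (s * c).
  move=> als bes; have B := bnd _ _ als bes.
  have [|D1 D2] := H (a + al *: u + be *: v).
    by rewrite /= -addrA opprD addrA subrr add0r normrN (le_lt_trans B).
  split => //; move: D2; rewrite -(addrA a) [a + _ - a]addrC addKr => /le_trans; apply.
  by apply: ler_wpM2l => //; exact: ltW.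
pose phi (t : R) := f (a + s *: u + t *: v) - f (a + t *: v).
have ss : 0 <= s <= s by rewrite lexx andbT ltW.
have zs : 0 <= (0 : R) <= s by rewrite lexx ltW.
have dphi (t : R) : 0 <= t <= s -> is_derive t 1 phi
    ('D_v f (a + s *: u + t *: v) - 'D_v f (a + t *: v)).
  move=> ts; apply: is_deriveB; apply: is_derive_line.
    by have [] := near_a _ _ ss ts.
  by have [] := near_a _ _ zs ts; rewrite scale0r addr0.
have [||xi] := MVT s0 (f := phi)
  (df := fun t => 'D_v f (a + s *: u + t *: v) - 'D_v f (a + t *: v)).
- by move=> t; rewrite in_itv/= => /andP[t0 ts]; apply: dphi; rewrite !ltW.
- apply: derivable_within_continuous => t; rewrite in_itv/= => ts.
  by have := dphi _ ts => /@ex_derive.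
rewrite in_itv/= => /andP[xi0 xis].
rewrite /phi scale0r !addr0 subr0 => E.
have xs : 0 <= xi <= s by rewrite !ltW.
have [_ D1] := near_a _ _ ss xs.
have [_ D2] := near_a _ _ zs xs.
have lin (al be : R) : 'd ('D_v f) a (al *: u + be *: v) =
    al * 'D_u ('D_v f) a + be * 'd ('D_v f) a v.
  by rewrite linearD !linearZ/= -(deriveE u).
move: D1 D2; rewrite !lin scale0r addr0 mul0r add0r.
set A := 'D_v f _; set B := 'D_v f _; set C := 'D_v f _; set D := 'D_u _ _.
set G := 'd _ _ _.
rewrite -/A -/C in E.
have -> : e / (2 * c) * (s * c) = e * s / 2 by field; rewrite gt_eqF.
move=> D1 D2.
have -> : f (a + s *: u + s *: v) - f (a + s *: u) - f (a + s *: v) + f a = (A - C) * s.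
  by rewrite -E; ring.
have -> : (A - C) * s - s ^+ 2 * D =
    s * ((A - B - (s * D + xi * G)) - (C - B - xi * G)) by ring.
rewrite normrM (gtr0_norm s0) expr2 mulrCA ler_pM2l//.
by rewrite (le_trans (ler_normB _ _))//; lra.
Unshelve. all: by end_near. Qed.

(** The second difference is symmetric in u and v, so both iterated derivatives
are limits of the same quotient. *)
Lemma derive_comm (f : V -> R) (a u v : V) : twice_differentiable f a ->
  'D_u ('D_v f) a = 'D_v ('D_u f) a.
Proof.
move=> fa; apply/eqP; rewrite -subr_eq0 -normr_le0.
apply/ler_addgt0Pr => e e0; rewrite add0r.
have e20 : 0 < e / 2 by rewrite divr_gt0.
have Huv := second_difference u v fa e20.
have Hvu := second_difference v u fa e20.
have H0 : \forall s \near (0 : R)^'+, 0 < s by exact: nbhs_right_gt.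
have [s [[s0 H1] H2]] := filter_ex (filterI (filterI H0 Huv) Hvu).
move: H2; rewrite [a + s *: v + _]addrAC [_ - f (a + s *: v) - _]addrAC => H2.
rewrite -(ler_pM2l (exprn_gt0 2 s0)) -{1}(ger0_norm (exprn_ge0 2 (ltW s0))) -normrM.
move: H1 H2; set D1 := 'D_u _ a; set D2 := 'D_v _ a; set X := _ + f a => H1 H2.
clearbody D1 D2 X.
have -> : s ^+ 2 * (D1 - D2) = (X - s ^+ 2 * D2) - (X - s ^+ 2 * D1) by ring.
by rewrite (le_trans (ler_normB _ _))//; lra.
Qed.

End Young.

(** * Differentiability of minimizers *)

Section Minimizers.
Context {R : realType}.

(** Convexity with plain real weights, so that it can be combined with the ring
and order tactics. *)
Definition convex_on_segments (W : lmodType R) (f : W -> R) :=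
  forall (t : R) (x1 x2 : W), 0 <= t <= 1 ->
    f (t *: x1 + (1 - t) *: x2) <= t * f x1 + (1 - t) * f x2.

(** Here t x is a convex combination of s x and of the minimizer x. *)
Lemma convex_ray_nonincreasing (W : lmodType R) (f : W -> R) (x : W) (t s : R) :
  convex_on_segments f -> (forall x', f x <= f x') ->
  s <= t -> t <= 1 -> f (t *: x) <= f (s *: x).
Proof.
move=> fconv xmin st t1.
have [->//|nst] := eqVneq s t.
have lst : s < t by rewrite lt_neqAle nst.
have s1 : 0 < 1 - s by lra.
pose a := (1 - t) / (1 - s).
have a01 : 0 <= a <= 1.
  by rewrite divr_ge0 ?(ltW s1) ?subr_ge0// ler_pdivrMr// mul1r; lra.
have -> : t *: x = a *: (s *: x) + (1 - a) *: x.
  rewrite scalerA -scalerDl; congr (_ *: _).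
  by rewrite /a; field; rewrite gt_eqF.
rewrite (le_trans (fconv _ _ _ a01))//.
move/andP: a01 => [a0 a1].
have := xmin (s *: x) => H.
have : (1 - a) * f x <= (1 - a) * f (s *: x) by rewrite ler_wpM2l ?subr_ge0.
by lra.
Qed.

Lemma is_derive_ge0 (W : normedModType R) (f : W -> R) (x u : W) (df : R) :
  is_derive x u f df -> (forall s : R, 0 < s -> s <= 1 -> f x <= f (s *: u + x)) ->
  0 <= df.
Proof.
move=> [fd <-] finc.
have {}fd : h^-1 *: ((f \o shift x) (h *: u) - f x) @[h --> 0^'] --> 'D_u f x by exact: fd.
have := cvg_dnbhs_at_right fd => {}fd.
apply: (cvgr_to_ge fd); near=> s.
have s0 : 0 < s by near: s; exact: nbhs_right_gt.
apply: mulr_ge0; first by rewrite invr_ge0 ltW.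
rewrite subr_ge0; apply: finc => //; near: s; exact: nbhs_right_le.
Unshelve. all: by end_near. Qed.

Lemma grad_eq0 (d : nat) (f : 'cV[R]_d -> R) (x g : 'cV[R]_d) :
  (forall u : 'cV[R]_d, is_derive x u f ((u^T *m g) 0 0)) ->
  (forall x', f x <= f x') -> g = 0.
Proof.
move=> fd xmin.
have ge0 (u : 'cV[R]_d) : 0 <= (u^T *m g) 0 0 by exact: is_derive_ge0 (fd u) _.
apply/colP => i; rewrite mxE.
have E : ((delta_mx i 0 : 'cV[R]_d)^T *m g) 0 0 = g i 0.
  by rewrite trmx_delta -rowE mxE.
apply/le_anti; rewrite -{1}oppr_ge0 -E.
have := ge0 (- delta_mx i 0); rewrite linearN mulNmx mxE => ->.
by rewrite ge0.
Qed.

Lemma posdef_unitmx (d : nat) (M : 'M[R]_d) :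
  (forall u : 'cV[R]_d, u != 0 -> 0 < (u^T *m M *m u) 0 0) -> M \in unitmx.
Proof.
move=> Mpos; rewrite -row_free_unit; apply: inj_row_free => v vM.
apply/eqP/negPn/negP => v0; have := Mpos v^T.
by rewrite trmxK vM mul0mx mxE ltxx trmx_eq0 => /(_ v0).
Qed.

Lemma near_norm_lt (V : normedModType R) (a : V) (r : R) : 0 < r ->
  \forall t \near a, `|t - a| < r.
Proof. by move=> r0; apply/nbhs_normP; exists r => // t; rewrite /= distrC. Qed.

(** An implicit function theorem for minimizers whose gradient G is known to be
differentiable at the single point (y, 0), which is too little for solving
G (y', u) = 0 by a contraction argument. Instead, convexity of F y' confines
the minimizers to a ball whose radius is proportional to the norm of y' - y, and
the linearization of G at (y, 0) locates them up to o(|y' - y|). *)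
Section ImplicitMinimizer.
Variables (V : normedModType R) (d : nat) (F : V -> 'cV[R]_d -> R).
Variables (G : V * 'cV[R]_d -> 'cV[R]_d) (w : V -> 'cV[R]_d) (y : V).
Variables (B : {linear V -> 'cV[R]_d}) (M : 'M[R]_d).
Hypothesis Bcont : continuous B.
Hypothesis Fconv : forall y', convex_on_segments (F y').
Hypothesis FG : \forall x \near (y, 0 : 'cV[R]_d),
  forall u, is_derive x.2 u (F x.1) ((u^T *m G x) 0 0).
Hypothesis Gdiff : is_diff (y, 0 : 'cV[R]_d) G (fun h => B h.1 + M *m h.2).
Hypothesis wmin : \forall y' \near y, forall u, F y' (w y') <= F y' u.
Hypothesis w0 : w y = 0.
Hypothesis Mpos : forall u : 'cV[R]_d, u != 0 -> 0 < (u^T *m M *m u) 0 0.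

Let G0 : G (y, 0) = 0.
Proof.
apply: (@grad_eq0 _ (F y) 0); first exact: (nbhs_singleton FG).
by move=> u; rewrite -[in leLHS]w0; exact: (nbhs_singleton wmin).
Qed.

Let near_linear (e : R) : 0 < e -> exists2 r, 0 < r & forall y' u,
  `|y' - y| < r -> `|u| < r ->
  `|G (y', u) - (B (y' - y) + M *m u)| <= e * Num.max `|y' - y| `|u|.
Proof.
move=> e0; have /nbhs_normP[r /= r0 H] := is_diff_norm_le Gdiff e0.
exists r => // y' u y'r ur.
have := H (y', u); rewrite /= prod_normE/= sub0r normrN distrC gt_max y'r ur.
by move=> /(_ isT); rewrite G0 !subr0 prod_normE/= subr0.
Qed.

Let near_derive : exists2 r, 0 < r & forall y' u, `|y' - y| < r -> `|u| < r ->
  forall v, is_derive u v (F y') ((v^T *m G (y', u)) 0 0).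
Proof.
have /nbhs_normP[r /= r0 H] := FG.
exists r => // y' u y'r ur v; apply: (H (y', u)).
by rewrite /= prod_normE/= sub0r normrN distrC gt_max y'r ur.
Qed.

(** Suppose that the norm of w y' exceeds C times that of y' - y. On the segment
from 0 to w y' choose a point u, small but still at least C times as long as
y' - y. There the linearization of G gives u^T G (y', u) >= m / 2 * |u|^2 > 0, so
F y' increases at u in the direction u, while convexity makes it nonincreasing
on the way to its minimizer w y'. *)
Lemma minimizer_lipschitz :
  exists2 C, 1 <= C & \forall y' \near y, `|w y'| <= C * `|y' - y|.
Proof.
have [m m0 mM] := quad_coercive Mpos.
have [b b0 bB] := linear_lipschitz Bcont.
pose D : R := d%:R + 1.
have D0 : 0 < D by rewrite ltr_wpDl.
(* C and the precision m / (4 D) make the label term and the linearization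
   error cost at most a quarter of the coercivity m |u|^2 each. *)
pose C := 4 * D * b / m + 1.
have C1 : 1 <= C by rewrite lerDr divr_ge0// ?mulr_ge0// ltW.
have C0 : 0 < C by rewrite (lt_le_trans _ C1).
have e0 : 0 < m / (4 * D) by rewrite divr_gt0// mulr_gt0.
have [r1 r10 H1] := near_linear e0.
have [r2 r20 H2] := near_derive.
pose r := Num.min r1 r2.
have r0 : 0 < r by rewrite lt_min r10.
exists C => //; near=> y'.
have wy'min : forall u, F y' (w y') <= F y' u by near: y'.
have hr : C * `|y' - y| < r / 2.
  rewrite -ltr_pdivlMl//; near: y'; apply: near_norm_lt.
  by rewrite mulr_gt0 ?invr_gt0 ?divr_gt0.
set h := `|y' - y| in hr *.
have h0 : 0 <= h by exact: normr_ge0.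
have hr' : h < r.
  have hC : h <= C * h by rewrite ler_peMl.
  have r2r : r / 2 < r by rewrite ltr_pdivrMr// mulr_natr mulr2n ltrDl.
  exact: le_lt_trans hC (lt_trans hr r2r).
rewrite leNgt; apply/negP => Cw.
have wpos : 0 < `|w y'| by rewrite (le_lt_trans _ Cw)// mulr_ge0// ltW.
pose t := Num.min `|w y'| (r / 2) / `|w y'|.
have rho0 : 0 < Num.min `|w y'| (r / 2) by rewrite lt_min wpos divr_gt0.
have t0 : 0 < t by rewrite divr_gt0.
have t1 : t <= 1 by rewrite ler_pdivrMr// mul1r ge_min lexx.
pose u := t *: w y'.
have nu : `|u| = Num.min `|w y'| (r / 2).
  by rewrite normrZ gtr0_norm// divfK// gt_eqF.
have ur : `|u| < r by rewrite nu gt_min ltr_pdivrMr// mulr_natr mulr2n ltrDl r0 orbT.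
have hu : C * h <= `|u| by rewrite nu le_min (ltW Cw) ltW.
have hu1 : h <= `|u| by rewrite (le_trans _ hu)// ler_peMl.
have u0 : 0 < `|u| by rewrite nu.
have [hr1 hr2] : h < r1 /\ h < r2.
  by move: hr'; rewrite lt_min => /andP[].
have [ur1 ur2] : `|u| < r1 /\ `|u| < r2.
  by move: ur; rewrite lt_min => /andP[].
have le0 : (u^T *m G (y', u)) 0 0 <= 0.
  rewrite -oppr_ge0; have := H2 y' u hr2 ur2 (- u).
  rewrite linearN mulNmx mxE => /is_derive_ge0; apply => s s0 s1.
  rewrite scalerN -scaleNr -{3}[u]scale1r -scalerDl /u scalerA.
  apply: convex_ray_nonincreasing => //.
  by have := mulr_ge0 (ltW s0) (ltW t0); lra.
have := H1 y' u hr1 ur1.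
rewrite (max_idPr hu1); set E := G _ - _ => Ele.
have GE : G (y', u) = M *m u + B (y' - y) + E by rewrite /E [M *m u + _]addrC subrKC.
clearbody E; move: le0; rewrite GE !mulmxDr mulmxA mxE [X in X + _]mxE.
apply/negP; rewrite -ltNge.
have HM := mM u.
have HB : - (m / 4 * `|u| ^+ 2) <= (u^T *m B (y' - y)) 0 0.
  have : `|(u^T *m B (y' - y)) 0 0| <= D * `|u| * (b * h).
    rewrite (le_trans (dot_norm_le _ _))//.
    by apply: ler_pM; rewrite ?mulr_ge0// ler_wpM2r// lerDl.
  have : D * `|u| * (b * h) <= m / 4 * `|u| ^+ 2.
    have -> : m / 4 * `|u| ^+ 2 = `|u| * (m / 4 * `|u|) by ring.
    have -> : D * `|u| * (b * h) = `|u| * (m / 4 * ((C - 1) * h)).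
      by rewrite /C; field; rewrite gt_eqF.
    rewrite ler_pM2l// ler_pM2l ?divr_gt0//.
    by rewrite (le_trans _ hu)// ler_wpM2r// gerBl.
  by rewrite ler_norml; move=> H3 /andP[H4 _]; lra.
have HE : - (m / 4 * `|u| ^+ 2) <= (u^T *m E) 0 0.
  have : `|(u^T *m E) 0 0| <= D * `|u| * (m / (4 * D) * `|u|).
    rewrite (le_trans (dot_norm_le _ _))//.
    by apply: ler_pM; rewrite ?mulr_ge0// ler_wpM2r// lerDl.
  have -> : D * `|u| * (m / (4 * D) * `|u|) = m / 4 * `|u| ^+ 2.
    by field; rewrite gt_eqF.
  by rewrite ler_norml => /andP[].
have : 0 < m * `|u| ^+ 2 by rewrite mulr_gt0// exprn_gt0.
by lra.
Unshelve. all: by end_near. Qed.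

(** Stationarity 0 = G (y', w y') = B (y' - y) + M w y' + o reads as the claim
after applying the inverse of M; by the Lipschitz bound the error is
o(|y' - y|). *)
Lemma is_diff_minimizer : is_diff y w (fun h => - (invmx M *m B h)).
Proof.
have [C C1 wlip] := minimizer_lipschitz.
have C0 : 0 < C by rewrite (lt_le_trans _ C1).
have MU := posdef_unitmx Mpos.
have Ic : continuous (mulmx (invmx M) : 'cV[R]_d -> 'cV[R]_d).
  exact: linear_mx_continuous.
have [k k0 kI] := linear_lipschitz Ic.
pose L : {linear V -> 'cV[R]_d} := \- (mulmx (invmx M) \o B).
apply: (@norm_le_is_diff _ _ _ _ L) => [x|e e0].
  apply: continuousN; apply: continuous_comp; first exact: Bcont.
  exact: Ic.
have e'0 : 0 < e / (k * C) by rewrite divr_gt0// mulr_gt0.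
have [r1 r10 H1] := near_linear e'0.
have [r2 r20 H2] := near_derive.
near=> y'.
have wy'min : forall u, F y' (w y') <= F y' u by near: y'.
have wy'lip : `|w y'| <= C * `|y' - y| by near: y'.
have hr : C * `|y' - y| < Num.min r1 r2.
  rewrite -ltr_pdivlMl//; near: y'; apply: near_norm_lt.
  by rewrite mulr_gt0 ?invr_gt0// lt_min r10.
have wr := le_lt_trans wy'lip hr.
have hhr : `|y' - y| < Num.min r1 r2 by rewrite (le_lt_trans _ hr)// ler_peMl.
move: wr hhr; rewrite !lt_min => /andP[wr1 wr2] /andP[hr1 hr2].
have Gw : G (y', w y') = 0.
  by apply: (@grad_eq0 _ (F y') (w y')) => // u; exact: H2.
have := H1 y' (w y') hr1 wr1; rewrite Gw sub0r normrN => H3.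
have -> : w y' - w y - L (y' - y) = invmx M *m (B (y' - y) + M *m w y').
  by rewrite w0 subr0 /L/= opprK mulmxDr mulKmx// addrC.
rewrite (le_trans (kI _))// -ler_pdivlMl// (le_trans H3)//.
have -> : k^-1 * (e * `|y' - y|) = e / (k * C) * (C * `|y' - y|).
  by field; rewrite !gt_eqF.
apply: ler_wpM2l; first exact: ltW.
by rewrite ge_max wy'lip ler_peMl.
Unshelve. all: by end_near. Qed.

End ImplicitMinimizer.
End Minimizers.

(** * Gradients, losses and quadratic programs *)

Section Gradients.
Context {R : realType}.

Lemma is_diff_is_derive (V W : normedModType R) (f df : V -> W) x u :
  is_diff x f df -> is_derive x u f (df u).
Proof.
move=> dfx; apply: DeriveDef; first by apply: diff_derivable; exact: ex_diff.
by rewrite deriveE ?diff_val//; exact: ex_diff.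
Qed.

Lemma near_eq_is_diff (V W : normedModType R) (f g : V -> W) (df : V -> W) a :
  (\forall t \near a, f t = g t) -> is_diff a f df -> is_diff a g df.
Proof.
move=> fg dfa; have da : differentiable f a by exact: ex_diff.
rewrite -(@diff_val _ _ _ _ _ _ _ dfa).
apply: norm_le_is_diff => [|e e0]; first exact: diff_continuous.
have fga := nbhs_singleton fg.
have := is_diff_norm_le (differentiableP da) e0.
move: fg; apply: filterS2 => t ->.
by rewrite fga.
Qed.

Lemma cV_sum_delta (n : nat) (x : 'cV[R]_n) : x = \sum_i x i 0 *: delta_mx i 0.
Proof.
by rewrite [LHS]matrix_sum_delta; apply: eq_bigr => i _; rewrite big_ord1.
Qed.

Definition gradient (q : nat) (f : 'cV[R]_q -> R) (x : 'cV[R]_q) : 'cV[R]_q :=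
  \col_j 'D_(delta_mx j 0) f x.

Lemma derive_gradient (q : nat) (f : 'cV[R]_q -> R) (x u : 'cV[R]_q) :
  differentiable f x -> 'D_u f x = (u^T *m gradient f x) 0 0.
Proof.
move=> df; rewrite deriveE// {1}(cV_sum_delta u) linear_sum mxE.
by apply: eq_bigr => i _; rewrite linearZ/= !mxE deriveE.
Qed.

Lemma hessian_sym (q : nat) (f : 'cV[R]_q -> R) (a : 'cV[R]_q) :
  twice_differentiable f a -> (hessian f a)^T = hessian f a.
Proof. by move=> fa; apply/matrixP => i j; rewrite !mxE derive_comm. Qed.

(** The rows of the derivative of the gradient are those of the transposed
Hessian, so the symmetry of the latter is used here. *)
Lemma is_diff_gradient (q : nat) (f : 'cV[R]_q -> R) (a : 'cV[R]_q) :
  twice_differentiable f a ->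
  is_diff a (gradient f) (fun h => hessian f a *m h).
Proof.
move=> fa; have [_ fd] := fa.
have := @is_diff_col R _ q (fun j => 'D_(delta_mx j 0) f)
  (fun j => 'd ('D_(delta_mx j 0) f) a) a (fun j => differentiableP (fd _)).
congr (is_diff_def _ _ _); apply/funext => h; apply/colP => j.
rewrite !mxE -deriveE; last exact: fd.
rewrite derive_gradient; last exact: fd.
rewrite mxE; apply: eq_bigr => i _.
rewrite !mxE mulrC (derive_comm (delta_mx i 0) (delta_mx j 0) fa).
exact: erefl.
Qed.

Lemma col_jacobian_mul (n m : nat) (f df : 'cV[R]_n -> 'cV[R]_m) a h :
  is_diff a f df -> col_jacobian f a *m h = df h.
Proof.
move=> dfa; have da : differentiable f a by exact: ex_diff.
rewrite -(@diff_val _ _ _ _ _ _ _ dfa).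
apply/colP => i; rewrite [in RHS](cV_sum_delta h) linear_sum summxE mxE.
by apply: eq_bigr => j _; rewrite linearZ/= !mxE deriveE// mulrC.
Qed.

End Gradients.

Section LossDerivatives.
Context {R : realType} (l : R -> R -> R).
Let lw (w : R * R) := l w.1 w.2.

Lemma derive_snd (f : R * R -> R) (y z : R) :
  'D_(0, 1) f (y, z) = derive1 (fun t => f (y, t)) z.
Proof.
rewrite /derive /derive1; set g1 := fun h : R => _; set g2 := fun h : R => _.
suff -> : g1 = g2 by [].
apply/funext => h; rewrite /g1 /g2/=.
have -> // : h *: ((0, 1) : R * R) + (y, z) = (y, h + z).
by congr pair; rewrite /= /GRing.scale/= ?mulr0 ?mulr1 ?add0r.
Qed.

Lemma derive_fst (f : R * R -> R) (y z : R) :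
  'D_(1, 0) f (y, z) = derive1 (fun t => f (t, z)) y.
Proof.
rewrite /derive /derive1; set g1 := fun h : R => _; set g2 := fun h : R => _.
suff -> : g1 = g2 by [].
apply/funext => h; rewrite /g1 /g2/=.
have -> // : h *: ((1, 0) : R * R) + (y, z) = (h + y, z).
by congr pair; rewrite /= /GRing.scale/= ?mulr0 ?mulr1 ?add0r.
Qed.

Hypothesis l_diff2 : forall u : R * R, twice_differentiable lw u.

Lemma loss1E (w : R * R) : loss1 l w.1 w.2 = 'D_(0, 1) lw w.
Proof. by case: w => y z; rewrite derive_snd. Qed.

Lemma is_diff_loss1 (u : R * R) :
  is_diff u (fun w : R * R => loss1 l w.1 w.2)
    (fun h => dloss1_dy l u.1 u.2 * h.1 + loss2 l u.1 u.2 * h.2).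
Proof.
have -> : (fun w : R * R => loss1 l w.1 w.2) = 'D_(0, 1) lw.
  by apply/funext => w; exact: loss1E.
have [_ /(_ (0, 1)) fd] := l_diff2 u.
apply: is_diff_eq; first exact: differentiableP fd.
apply/funext => -[h1 h2] /=.
have -> : (h1, h2) = h1 *: (1, 0) + h2 *: (0, 1) :> R * R.
  by congr pair; rewrite /= /GRing.scale/= ?mulr0 ?mulr1 ?addr0 ?add0r.
rewrite linearD !linearZ/= -!deriveE//.
case: u fd => y z fd /=; rewrite derive_fst derive_snd.
have -> : (fun t => 'D_(0, 1) lw (t, z)) = loss1 l ^~ z.
  by apply/funext => t; rewrite -loss1E.
have -> : (fun t => 'D_(0, 1) lw (y, t)) = loss1 l y.
  by apply/funext => t; rewrite -loss1E.
rewrite -/(dloss1_dy l y z) -/(loss2 l y z) /GRing.scale/=.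
by rewrite (mulrC h1) (mulrC h2).
Qed.

Lemma is_diff_loss (y z : R) : is_diff z (l y) (fun h => h * loss1 l y z).
Proof.
have d : differentiable lw (y, z) by have [/nbhs_singleton] := l_diff2 (y, z).
have dz : differentiable (l y) z.
  have -> : l y = lw \o (fun t => (y, t)) by [].
  by apply: differentiable_comp => //; apply: differentiable_pair.
apply: is_diff_eq; first exact: differentiableP dz.
by rewrite diff1E.
Qed.

End LossDerivatives.

Section QuadraticProgram.
Context {R : realType}.

Lemma quad_ge0_lin0 (g a : R) : (forall t : R, 0 <= t * g + t ^+ 2 * a) -> g = 0.
Proof.
move=> H; apply/eqP/negPn/negP => g0.
have c0 : 0 < `|a| + 1 by rewrite ltr_wpDl.
(* A step against g, short enough for the linear term to dominate. *)
have := H (- g / (`|a| + 1)).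
have -> : - g / (`|a| + 1) * g + (- g / (`|a| + 1)) ^+ 2 * a =
   (g / (`|a| + 1)) ^+ 2 * (a - `|a| - 1) by field; rewrite gt_eqF.
rewrite pmulr_rge0; last by rewrite exprn_even_gt0//= mulf_neq0// invr_neq0// gt_eqF.
by have := ler_norm a; lra.
Qed.

(** Uniqueness carries all the definiteness that is needed: along a feasible
direction e the objective changes by t g + t^2 a with g = 0, so a nonzero e with
a <= 0 would produce a second minimizer v + e. *)
Lemma quad_unique_minimizer (p : nat) (Q : 'M[R]_p) (b : 'cV[R]_p)
    (D : set 'cV[R]_p) (v : 'cV[R]_p) :
  Q^T = Q -> (forall x e (t : R), D x -> D e -> D (x + t *: e)) ->
  unique (minimizer D (fun x => 2^-1 * (x^T *m Q *m x) 0 0 - (x^T *m b) 0 0)) v ->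
  (forall e, D e -> (e^T *m (Q *m v - b)) 0 0 = 0) /\
  (forall e, D e -> e != 0 -> 0 < (e^T *m Q *m e) 0 0).
Proof.
move=> Qsym Dadd [[Dv vmin] vuniq].
pose phi (x : 'cV[R]_p) := 2^-1 * (x^T *m Q *m x) 0 0 - (x^T *m b) 0 0.
have {}vmin x : D x -> phi v <= phi x by exact: vmin.
have {}vuniq x : minimizer D phi x -> v = x by exact: vuniq.
have sym (e : 'cV[R]_p) : (v^T *m Q *m e) 0 0 = (e^T *m Q *m v) 0 0.
  transitivity ((v^T *m Q *m e)^T 0 0); first by rewrite [RHS]mxE.
  by rewrite !trmx_mul Qsym trmxK mulmxA.
have phiD (e : 'cV[R]_p) (t : R) : phi (v + t *: e) = phi v +
    (t * (e^T *m (Q *m v - b)) 0 0 + t ^+ 2 * (2^-1 * (e^T *m Q *m e) 0 0)).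
  have -> : (e^T *m (Q *m v - b)) 0 0 = (e^T *m Q *m v) 0 0 - (e^T *m b) 0 0.
    by rewrite mulmxBr mulmxA mxE [X in _ + X]mxE.
  have -> : phi (v + t *: e) =
      2^-1 * ((v^T *m Q *m v) 0 0 + t * (v^T *m Q *m e) 0 0
        + t * ((e^T *m Q *m v) 0 0 + t * (e^T *m Q *m e) 0 0))
      - ((v^T *m b) 0 0 + t * (e^T *m b) 0 0).
    have tD : (v + t *: e)^T = v^T + t *: e^T by rewrite linearD linearZ.
    rewrite /phi tD !mulmxDl !mulmxDr -!scalemxAl -!scalemxAr.
    move: (v^T *m Q *m v) (v^T *m Q *m e) (e^T *m Q *m v) (e^T *m Q *m e).
    by move=> a1 a2 a3 a4; move: (v^T *m b) (e^T *m b) => a5 a6; rewrite !mxE; ring.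
  rewrite sym /phi.
  move: ((v^T *m Q *m v) 0 0) ((e^T *m Q *m v) 0 0) ((e^T *m Q *m e) 0 0).
  move: ((v^T *m b) 0 0) ((e^T *m b) 0 0) => a1 a2 a3 a4 a5.
  by field.
have lin0 e : D e -> (e^T *m (Q *m v - b)) 0 0 = 0.
  move=> De; apply: (@quad_ge0_lin0 _ (2^-1 * (e^T *m Q *m e) 0 0)) => t.
  by have := vmin _ (Dadd v e t Dv De); rewrite phiD lerDl.
split=> // e De e0; rewrite ltNge; apply/negP => le0.
have : v = v + 1 *: e.
  apply: vuniq; split; first exact: Dadd.
  move=> x Dx; rewrite (le_trans _ (vmin x Dx))// phiD lin0// mulr0 add0r.
  by rewrite expr1n mul1r gerDl pmulr_rle0.
rewrite scale1r => /eqP; rewrite eq_sym -subr_eq0 addrC addKr => /eqP e00.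
by rewrite e00 eqxx in e0.
Qed.

(** Coordinates on the common kernel of the matrices A k. The left inverse L reads
off the coordinates of a kernel vector. *)
Lemma common_kernel_basis (I : finType) (P : pred I) (p : nat) (q : I -> nat)
    (A : forall k : I, 'M[R]_(q k, p)) :
  exists d (N : 'M[R]_(p, d)) (L : 'M[R]_(d, p)),
  [/\ L *m N = 1%:M, forall k, P k -> A k *m N = 0 &
      forall v : 'cV[R]_p, (forall k, P k -> A k *m v = 0) -> v = N *m (L *m v)].
Proof.
pose U := (\bigcap_(k | P k) kermx (A k)^T)%MS.
have /row_freeP[B NB] : row_free (row_base U) by exact: row_base_free.
exists (\rank U), (row_base U)^T, B^T; split.
- by rewrite -trmx_mul NB trmx1.
- move=> k Pk; apply: trmx_inj; rewrite trmx_mul trmxK trmx0.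
  by apply/sub_kermxP; rewrite eq_row_base; exact: bigcapmx_inf Pk _.
- move=> v Av.
  have : (v^T <= row_base U)%MS.
    rewrite eq_row_base; apply/sub_bigcapmxP => k Pk; apply/sub_kermxP.
    by rewrite -trmx_mul Av// trmx0.
  move=> /submxP[D vD]; have -> : v = (row_base U)^T *m D^T.
    by rewrite -trmx_mul -vD trmxK.
  by rewrite (mulmxA B^T) -(trmx_mul (row_base U)) NB trmx1 mul1mx.
Qed.

End QuadraticProgram.

(** * Convexity and differentiation rules *)

Section Convexity.
Context {R : realType}.

Lemma convex_on_segments_comp (V W : lmodType R) (g : V -> W) (f : W -> R) :
  (forall (t : R) x1 x2, g (t *: x1 + (1 - t) *: x2) = t *: g x1 + (1 - t) *: g x2) ->
  convex_on_segments f -> convex_on_segments (f \o g).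
Proof. by move=> gaff fc t x1 x2 t01 /=; rewrite gaff fc. Qed.

Lemma convex_on_segmentsD (W : lmodType R) (f g : W -> R) :
  convex_on_segments f -> convex_on_segments g ->
  convex_on_segments (fun x => f x + g x).
Proof.
move=> fc gc t x1 x2 t01; rewrite !mulrDr addrACA.
by apply: lerD; [exact: fc|exact: gc].
Qed.

Lemma convex_on_segments_sum (W : lmodType R) (I : finType) (f : I -> W -> R) :
  (forall i, convex_on_segments (f i)) ->
  convex_on_segments (fun x => \sum_i f i x).
Proof.
move=> fc t x1 x2 t01; rewrite !mulr_sumr -big_split.
by apply: ler_sum => i _; exact: fc.
Qed.

Lemma strictly_convex_on_segments (f : R -> R) :
  strictly_convex f -> convex_on_segments (f : R^o -> R).
Proof.
move=> fc t x1 x2 /andP[t0 t1]; rewrite /GRing.scale/=.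
have [->|tn0] := eqVneq t 0; first by rewrite subr0 !mul0r !mul1r !add0r.
have [->|tn1] := eqVneq t 1; first by rewrite subrr !mul0r !mul1r !addr0.
have [->|x12] := eqVneq x1 x2; first by rewrite -!mulrDl addrC subrK !mul1r.
apply/ltW/fc => //; by rewrite !lt_neqAle eq_sym tn0 t0 tn1 t1.
Qed.

Lemma convex_function_on_segments (W : lmodType R) (f : W -> R) :
  convex_function setT f -> convex_on_segments f.
Proof.
move=> fc t x1 x2 /andP[t0 t1].
by have := fc (Itv01 t0 t1) x1 x2; rewrite !inE => /(_ I I).
Qed.

Lemma erm_objective_convex (n p K : nat) (l : R -> R -> R) (X : 'M[R]_(n, p))
    (q : 'I_K.+1 -> nat) (A : forall k, 'M[R]_(q k, p))
    (c : forall k, 'cV[R]_(q k)) (r : forall k, 'cV[R]_(q k) -> R) y :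
  (forall t, strictly_convex (l t)) -> (forall k, convex_function setT (r k)) ->
  convex_on_segments (erm_objective l X A c r y).
Proof.
move=> lc rc; apply: convex_on_segmentsD; apply: convex_on_segments_sum => i.
- apply: (@convex_on_segments_comp _ _ (fun b : 'cV[R]_p => (X *m b) i 0 : R^o)
    (l (y i 0))); last exact: strictly_convex_on_segments.
  by move=> t x1 x2; rewrite mulmxDr -!scalemxAr !mxE.
- apply: (@convex_on_segments_comp _ _ (fun b : 'cV[R]_p => A i *m b + c i) (r i));
    last exact: convex_function_on_segments.
  move=> t x1 x2; rewrite mulmxDr -!scalemxAr !scalerDr addrACA -scalerDl.
  by rewrite addrC [t + _]addrC subrK scale1r addrC.
Qed.

End Convexity.

Section DiffRules.
Context {R : realType}.

Lemma is_diff_coord (V : normedModType R) (m n : nat) (f df : V -> 'M[R]_(m, n)) x i j :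
  is_diff x f df -> is_diff x (fun t => f t i j) (fun t => df t i j).
Proof.
move=> dfx; have df' : differentiable f x by exact: ex_diff.
rewrite -(@diff_val _ _ _ _ _ _ _ dfx).
pose co (M : 'M[R]_(m, n)) : R := M i j.
have colin : linear co by move=> a M1 M2; rewrite /co !mxE.
pose coM := GRing.isLinear.Build _ _ _ _ _ colin.
pose coL : {linear 'M[R]_(m, n) -> R} := HB.pack co coM.
have cc : continuous coL by exact: coord_continuous.
have dc : is_diff (f x) coL coL.
  by apply: DiffDef; [exact: linear_differentiable|exact: diff_lin].
have := @is_diff_comp R V _ _ f _ coL coL x (differentiableP df') dc.
by [].
Qed.

Lemma is_diff_sum (V W : normedModType R) (I : Type) (s : seq I) (P : pred I)
    (f df : I -> V -> W) x :
  (forall i, P i -> is_diff x (f i) (df i)) ->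
  is_diff x (fun t => \sum_(i <- s | P i) f i t)
    (fun t => \sum_(i <- s | P i) df i t).
Proof.
move=> dfx.
have E (g : I -> V -> W) : (fun t => \sum_(i <- s | P i) g i t) =
    \sum_(i <- s | P i) g i by apply/funext => t; rewrite fct_sumE.
rewrite !E; elim/big_ind2 : _ => [|f1 g1 f2 g2|i Pi].
- exact: is_diff_cst.
- exact: is_diffD.
- exact: dfx.
Qed.

Lemma is_diff_affine (V : normedModType R) (m n : nat) (M : 'M[R]_(m, n))
    (c : 'cV[R]_m) (f df : V -> 'cV[R]_n) x :
  is_diff x f df -> is_diff x (fun t => M *m f t + c) (fun t => M *m df t).
Proof.
move=> dfx; have := is_diffD (is_diff_mulmx M dfx) (is_diff_cst c x).
by rewrite addr0.
Qed.

Lemma is_diff_fst (V W : normedModType R) (x : V * W) : is_diff x fst fst.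
Proof.
apply: DiffDef.
  by apply: (@linear_differentiable _ _ _ fst) => t; exact: cvg_fst.
by rewrite (@diff_lin _ _ _ fst) // => t; exact: cvg_fst.
Qed.

Lemma is_diff_snd (V W : normedModType R) (x : V * W) : is_diff x snd snd.
Proof.
apply: DiffDef.
  by apply: (@linear_differentiable _ _ _ snd) => t; exact: cvg_snd.
by rewrite (@diff_lin _ _ _ snd) // => t; exact: cvg_snd.
Qed.

End DiffRules.

(** * The problem restricted to a fixed active set *)

Lemma col_mul_diagD (R : realType) (n : nat) (d1 d2 : 'I_n -> R) (x1 x2 : 'cV[R]_n) :
  \col_i (d1 i * x1 i 0 + d2 i * x2 i 0) =
  diag_mx (\row_i d1 i) *m x1 + diag_mx (\row_i d2 i) *m x2.
Proof. by apply/colP => i; rewrite !mul_diag_mx !mxE. Qed.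

Lemma diag_mul_quotient (R : realType) (n : nat) (a d : 'I_n -> R) (z : 'cV[R]_n) :
  (forall j, d j != 0) ->
  diag_mx (\row_j d j) *m (\col_j - (a j / d j * z j 0)) =
  - (diag_mx (\row_j a j) *m z).
Proof.
move=> d0; apply/colP => j; rewrite !mul_diag_mx !mxE.
by field.
Qed.

(** While the active set keeps its value at b, every solution lies in b + W, with
W the common kernel of the A k for k not active. Writing its points as b + N w,
with the columns of N in W, gives an unconstrained problem in w. *)
Section ReducedProblem.
Context {R : realType} {n p K d : nat}.
Variables (l : R -> R -> R) (X : 'M[R]_(n, p)).
Variables (q : 'I_K.+1 -> nat) (A : forall k, 'M[R]_(q k, p)).
Variables (c : forall k, 'cV[R]_(q k)) (r : forall k, 'cV[R]_(q k) -> R).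
Variables (y : 'cV[R]_n) (b : 'cV[R]_p) (N : 'M[R]_(p, d)).
Hypothesis l_diff2 : forall u : R * R,
  twice_differentiable (fun w : R * R => l w.1 w.2) u.
Hypothesis r_diff2 : forall k, k \in active_set A c b ->
  twice_differentiable (@r k) (A k *m b + c k).
Hypothesis AN0 : forall k, k \notin active_set A c b -> A k *m N = 0.

Definition reduced_objective (y' : 'cV[R]_n) (w : 'cV[R]_d) : R :=
  erm_objective l X A c r y' (b + N *m w).

(** The gradient in w of the reduced objective, as a function of the labels and
of w. The penalties outside the active set are constant along b + N w. *)
Definition reduced_gradient (x : 'cV[R]_n * 'cV[R]_d) : 'cV[R]_d :=
  (X *m N)^T *m
    (\col_i loss1 l (x.1 i 0) ((X *m N *m x.2 + X *m b) i 0)) +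
  \sum_(k in active_set A c b) (A k *m N)^T *m
    gradient (@r k) (A k *m N *m x.2 + (A k *m b + c k)).

(** The derivative of the reduced gradient with respect to the labels. *)
Definition label_sensitivity : 'M[R]_(d, n) :=
  (X *m N)^T *m diag_mx (\row_i dloss1_dy l (y i 0) ((X *m b) i 0)).

Lemma reduced_objectiveE (y' : 'cV[R]_n) :
  reduced_objective y' =
  \sum_i (fun w => l (y' i 0) ((X *m N *m w + X *m b) i 0)) +
  \sum_k (fun w => r (A k *m N *m w + (A k *m b + c k))).
Proof.
apply/funext => w; rewrite addrfctE !fct_sumE /reduced_objective /erm_objective.
congr (_ + _); apply: eq_bigr => i _; rewrite mulmxDr mulmxA.
  by rewrite addrC.
by rewrite addrA [_ *m w + _]addrC.
Qed.

(** Near w = 0 the arguments of the active penalties stay where these penalties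
are differentiable; the other ones do not depend on w. *)
Lemma reduced_gradient_correct : \forall x \near (y, 0 : 'cV[R]_d),
  forall u, is_derive x.2 u (reduced_objective x.1)
    ((u^T *m reduced_gradient x) 0 0).
Proof.
have rd : \forall x \near (y, 0 : 'cV[R]_d), forall k : 'I_K.+1,
    k \in active_set A c b ->
    differentiable (@r k) (A k *m N *m x.2 + (A k *m b + c k)).
  apply: (filter_forall (nbhs_filter (y, 0 : 'cV[R]_d))) => k.
  have [kS|kS] := boolP (k \in active_set A c b); last by apply: nearW.
  have [rk _] := r_diff2 kS.
  have : {for (y, 0 : 'cV[R]_d), continuous
      (fun x : 'cV[R]_n * 'cV[R]_d => A k *m N *m x.2 + (A k *m b + c k))}.
    apply: differentiable_continuous.
    have D := is_diff_affine (A k *m N) (A k *m b + c k)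
      (is_diff_snd (y, 0 : 'cV[R]_d)).
    exact: (@ex_diff _ _ _ _ _ _ _ D).
  rewrite /prop_for /continuous_at /= mulmx0 add0r => /(_ _ rk) Hn.
  by apply: (@filterS _ _ (nbhs_filter (y, 0 : 'cV[R]_d)) _ _ _ Hn) => x Hx _.
near=> x => u.
have rdx : forall k : 'I_K.+1, k \in active_set A c b ->
    differentiable (@r k) (A k *m N *m x.2 + (A k *m b + c k)) by near: x.
rewrite reduced_objectiveE /reduced_gradient mulmxDr mxE.
apply: is_deriveD.
- have -> : (u^T *m ((X *m N)^T *m
      (\col_i loss1 l (x.1 i 0) ((X *m N *m x.2 + X *m b) i 0)))) 0 0 =
    \sum_i (X *m N *m u) i 0 * loss1 l (x.1 i 0) ((X *m N *m x.2 + X *m b) i 0).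
    rewrite mulmxA -trmx_mul mxE; apply: eq_bigr => i _.
    by rewrite !mxE.
  apply: is_derive_sum => i.
  have D1 : is_diff (x.2) (fun w => (X *m N *m w + X *m b) i 0)
      (fun h => (X *m N *m h) i 0).
    by apply: is_diff_coord; apply: is_diff_affine; exact: is_diff_id.
  have D2 := is_diff_loss l_diff2 (x.1 i 0) ((X *m N *m x.2 + X *m b) i 0).
  by have D := is_diff_comp D1 D2; exact: (is_diff_is_derive u D).
- have -> : (u^T *m \sum_(k in active_set A c b) (A k *m N)^T *m
      gradient (@r k) (A k *m N *m x.2 + (A k *m b + c k))) 0 0 =
    \sum_k (if k \in active_set A c b then
      ((A k *m N *m u)^T *m
        gradient (@r k) (A k *m N *m x.2 + (A k *m b + c k))) 0 0 else 0).
    rewrite mulmx_sumr summxE big_mkcond; apply: eq_bigr => k _.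
    by case: ifP => // _; rewrite mulmxA -trmx_mul.
  apply: is_derive_sum => k.
  have [kS|kS] := boolP (k \in active_set A c b); last first.
    have -> : (fun w => r (A k *m N *m w + (A k *m b + c k))) =
        cst (r (A k *m b + c k)).
      by apply/funext => w; rewrite AN0// mul0mx add0r.
    exact: is_derive_cst.
  have D1 : is_diff (x.2) (fun w => A k *m N *m w + (A k *m b + c k))
      (fun h => A k *m N *m h).
    by apply: is_diff_affine; exact: is_diff_id.
  have D2 := differentiableP (rdx k kS).
  have D := is_diff_comp D1 D2.
  have := is_diff_is_derive u D.
  by rewrite /= -deriveE ?derive_gradient//; exact: rdx.
Unshelve. all: by end_near. Qed.

(** The derivative in w is the matrix of the quadratic program, compressed by
N. *)
Lemma is_diff_reduced_gradient :
  is_diff (y, 0 : 'cV[R]_d) reduced_gradient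
    (fun h => label_sensitivity *m h.1 + N^T *m qp_matrix l X A c r y b *m N *m h.2).
Proof.
have D1 : is_diff (y, 0 : 'cV[R]_d) (fun x : 'cV[R]_n * 'cV[R]_d =>
    (\col_i loss1 l (x.1 i 0) ((X *m N *m x.2 + X *m b) i 0)))
  (fun h => \col_i (dloss1_dy l (y i 0) ((X *m b) i 0) * h.1 i 0 +
     loss2 l (y i 0) ((X *m b) i 0) * (X *m N *m h.2) i 0)).
  apply: is_diff_col => i.
  have E1 : is_diff (y, 0 : 'cV[R]_d) (fun x : 'cV[R]_n * 'cV[R]_d => x.1 i 0)
      (fun h => h.1 i 0) by apply: is_diff_coord; exact: is_diff_fst.
  have E2 : is_diff (y, 0 : 'cV[R]_d)
      (fun x : 'cV[R]_n * 'cV[R]_d => (X *m N *m x.2 + X *m b) i 0)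
      (fun h => (X *m N *m h.2) i 0).
    by apply: is_diff_coord; apply: is_diff_affine; exact: is_diff_snd.
  have E3 := is_diff_loss1 l_diff2 (y i 0, (X *m N *m (0 : 'cV[R]_d) + X *m b) i 0).
  have := is_diff_comp (is_diff_pair E1 E2) E3.
  by rewrite mulmx0 add0r.
have D2 := is_diff_mulmx (X *m N)^T D1.
have D3 : is_diff (y, 0 : 'cV[R]_d) (fun x : 'cV[R]_n * 'cV[R]_d =>
  \sum_(k in active_set A c b) (A k *m N)^T *m
    gradient (@r k) (A k *m N *m x.2 + (A k *m b + c k)))
  (fun h => \sum_(k in active_set A c b) (A k *m N)^T *m
    (hessian (@r k) (A k *m b + c k) *m (A k *m N *m h.2))).
  apply: (@is_diff_sum _ _ _ _ _ _
    (fun k (x : 'cV[R]_n * 'cV[R]_d) => (A k *m N)^T *m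
      gradient (@r k) (A k *m N *m x.2 + (A k *m b + c k)))
    (fun k h => (A k *m N)^T *m
      (hessian (@r k) (A k *m b + c k) *m (A k *m N *m h.2)))) => k kS.
  apply: is_diff_mulmx.
  have E1 : is_diff (y, 0 : 'cV[R]_d)
      (fun x : 'cV[R]_n * 'cV[R]_d => A k *m N *m x.2 + (A k *m b + c k))
      (fun h => A k *m N *m h.2).
    by apply: is_diff_affine; exact: is_diff_snd.
  have E2 := is_diff_gradient (r_diff2 kS).
  apply: (is_diff_comp E1); move: E2.
  by rewrite /= mulmx0 add0r.
apply: (@is_diff_eq _ _ _ reduced_gradient _ _ _ (is_diffD D2 D3)).
apply/funext => h; rewrite fctE /qp_matrix mulmxDr !mulmxDl addrA; congr (_ + _).
- have -> : \col_i (dloss1_dy l (y i 0) ((X *m b) i 0) * h.1 i 0 +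
     loss2 l (y i 0) ((X *m b) i 0) * (X *m N *m h.2) i 0) =
     diag_mx (\row_i dloss1_dy l (y i 0) ((X *m b) i 0)) *m h.1 +
     loss_hessian l y (X *m b) *m (X *m N *m h.2).
    exact: col_mul_diagD.
  rewrite /label_sensitivity.
  move: (diag_mx _) (loss_hessian _ _ _) h.1 h.2 => D H h1 h2.
  by rewrite mulmxDr trmx_mul !mulmxA.
- rewrite mulmx_sumr !mulmx_suml; apply: eq_bigr => k _.
  by rewrite trmx_mul !mulmxA.
Qed.

End ReducedProblem.

Lemma qp_matrix_sym (R : realType) (n p K : nat) (l : R -> R -> R)
    (X : 'M[R]_(n, p)) (q : 'I_K.+1 -> nat) (A : forall k, 'M[R]_(q k, p))
    (c : forall k, 'cV[R]_(q k)) (r : forall k, 'cV[R]_(q k) -> R)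
    (y : 'cV[R]_n) (b : 'cV[R]_p) :
  (forall k, k \in active_set A c b ->
     twice_differentiable (r k) (A k *m b + c k)) ->
  (qp_matrix l X A c r y b)^T = qp_matrix l X A c r y b.
Proof.
move=> rd; rewrite /qp_matrix linearD/= linear_sum/=; congr (_ + _).
  by rewrite !trmx_mul trmxK tr_diag_mx mulmxA.
apply: eq_bigr => k kS.
by rewrite !trmx_mul trmxK hessian_sym ?mulmxA//; exact: rd.
Qed.

(** * Sensitivity of the predictions *)

Theorem theorem2 (R : realType) (n p K : nat)
  (l : R -> R -> R)
  (l_diff2 : forall u : R * R, twice_differentiable (fun w : R * R => l w.1 w.2) u)
  (l_conv : forall y : R, strictly_convex (l y))
  (q : 'I_K.+1 -> nat)
  (A : forall k : 'I_K.+1, 'M[R]_(q k, p))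
  (c : forall k : 'I_K.+1, 'cV[R]_(q k))
  (r : forall k : 'I_K.+1, 'cV[R]_(q k) -> R)
  (r_conv : forall k : 'I_K.+1, convex_function setT (r k))
  (X : 'M[R]_(n, p)) (y : 'cV[R]_n)
  (bhat : 'cV[R]_n -> 'cV[R]_p)
  (bhat_min : \forall y' \near y,
     minimizer setT (erm_objective l X A c r y') (bhat y'))
  (yhat : 'cV[R]_n -> 'cV[R]_n)
  (yhatE : yhat = fun y' => X *m bhat y')
  (dl_neq0 : forall j : 'I_n, dloss1_dy l (y j 0) (yhat y j 0) != 0)
  (r0_diff2 : forall x : 'cV[R]_(q ord0), twice_differentiable (r ord0) x)
  (rk_diff2 : forall k : 'I_K.+1, k != ord0 ->
     forall x : 'cV[R]_(q k), x != 0 -> twice_differentiable (r k) x)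
  (S_const : \forall y' \near y, active_set A c (bhat y') = active_set A c (bhat y))
  (z : 'cV[R]_n) (v : 'cV[R]_p)
  (v_sol : unique (minimizer (qp_feasible A c (bhat y))
                             (qp_objective l X A c r y (bhat y) z)) v) :
  differentiable yhat y /\
  normalized_jacobian l yhat y *m z = X *m v.
Proof.
set b := bhat y in S_const v_sol.
have yb : yhat y = X *m b by rewrite yhatE.
rewrite yb in dl_neq0.
have r_diff2 k : k \in active_set A c b -> twice_differentiable (r k) (A k *m b + c k).
  rewrite inE; have [->|k0] := eqVneq k ord0; first by move=> _; exact: r0_diff2.
  by move=> /=; exact: rk_diff2.
set Q := qp_matrix l X A c r y b.
set H := loss_hessian l y (X *m b).
have [lin0 pos] : (forall e, qp_feasible A c b e ->
      (e^T *m (Q *m v - X^T *m H *m z)) 0 0 = 0) /\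
    (forall e, qp_feasible A c b e -> e != 0 -> 0 < (e^T *m Q *m e) 0 0).
  apply: (@quad_unique_minimizer _ _ Q _ (qp_feasible A c b)).
  - exact: qp_matrix_sym.
  - move=> x e t xW eW k kS.
    by rewrite mulmxDr -scalemxAr xW// eW// scaler0 addr0.
  - move: v_sol; congr (unique (minimizer _ _) _).
    by apply/funext => x; rewrite /qp_objective -/Q -/H !mulmxA.
have [d [N [L [LN AN0 NL]]]] :=
  common_kernel_basis (fun k => k \notin active_set A c b) A.
have Nfeas (u : 'cV[R]_d) : qp_feasible A c b (N *m u).
  by move=> k kS; rewrite mulmxA AN0// mul0mx.
have vN : v = N *m (L *m v) by apply: NL; have [[]] := v_sol.
(* Restricted to W, the program says that L v solves M (L v) = N^T X^T H z with
   M positive definite. *)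
set M := N^T *m Q *m N.
have Mpos (u : 'cV[R]_d) : u != 0 -> 0 < (u^T *m M *m u) 0 0.
  move=> u0; have := pos _ (Nfeas u); rewrite trmx_mul /M !mulmxA; apply.
  by apply: contra_neq u0 => Nu0; rewrite -[u]mul1mx -LN -mulmxA Nu0 mulmx0.
have Mv : M *m (L *m v) = N^T *m (X^T *m H *m z).
  rewrite /M -[in LHS]mulmxA -vN -mulmxA; apply/eqP; rewrite -subr_eq0 -mulmxBr.
  apply/eqP/colP => i; rewrite [RHS]mxE.
  have := lin0 _ (Nfeas (delta_mx i 0)).
  by rewrite trmx_mul -(mulmxA _ N^T) trmx_delta -rowE mxE.
(* Since the active set is locally constant, bhat stays in b + W. *)
set w := fun y' => L *m (bhat y' - b).
have bw : \forall y' \near y, bhat y' = b + N *m w y'.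
  move: S_const; apply: filterS => y' SE; rewrite /w -NL ?subrKC// => k kS.
  have inact b' : k \notin active_set A c b' -> A k *m b' = - c k.
    by rewrite inE negb_or negbK addr_eq0 => /andP[_ /eqP].
  by rewrite mulmxBr !inact ?subrr// SE.
set B := label_sensitivity l X y b N.
have dw : is_diff y w (fun h => - (invmx M *m (B *m h))).
  apply: (@is_diff_minimizer _ _ _ (reduced_objective l X A c r b N)
    (reduced_gradient l X A c r b N) w y (mulmx B) M).
  - exact: linear_mx_continuous.
  - move=> y' t x1 x2 t01; rewrite /reduced_objective.
    have := erm_objective_convex X A c y' l_conv r_conv (b + N *m x1) (b + N *m x2) t01.
    congr (erm_objective _ _ _ _ _ _ _ <= _).
    rewrite mulmxDr -!scalemxAr !scalerDr addrACA -scalerDl.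
    by rewrite [t + _]addrC subrK scale1r.
  - exact: reduced_gradient_correct.
  - exact: is_diff_reduced_gradient.
  - move: bhat_min bw; apply: filterS2 => y' [_ ymin] bwy' u.
    by rewrite /reduced_objective -bwy'; exact: ymin.
  - by rewrite /w subrr mulmx0.
  - exact: Mpos.
have dy : is_diff y yhat (fun h => X *m N *m - (invmx M *m (B *m h))).
  apply: (@near_eq_is_diff _ _ _ (fun y' => X *m N *m w y' + X *m b)).
    move: bw; apply: filterS => y' bwy'.
    by rewrite yhatE bwy' mulmxDr mulmxA addrC.
  exact: is_diff_affine.
split; first exact: ex_diff.
(* Scaling the columns of the Jacobian amounts to scaling the direction: moving
   the labels along g changes the loss derivatives by - H z. *)
pose g : 'cV[R]_n := \col_j - (loss2 l (y j 0) ((X *m b) j 0) /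
  dloss1_dy l (y j 0) ((X *m b) j 0) * z j 0).
have -> : normalized_jacobian l yhat y *m z = col_jacobian yhat y *m g.
  apply/colP => i; rewrite [LHS]mxE [RHS]mxE; apply: eq_bigr => j _.
  by rewrite [normalized_jacobian _ _ _ _ _]mxE [g _ _]mxE yb !mulNr mulrN
    -[in LHS]mulrA.
have Bg : B *m g = - (N^T *m (X^T *m H *m z)).
  rewrite /B /label_sensitivity trmx_mul -!mulmxA.
  transitivity (N^T *m (X^T *m - (H *m z))); last by rewrite !mulmxN.
  congr (_ *m (_ *m _)).
  exact: (diag_mul_quotient (fun j => loss2 l (y j 0) ((X *m b) j 0)) z dl_neq0).
rewrite (col_jacobian_mul _ dy) Bg !mulmxN opprK -Mv.
by rewrite mulKmx ?posdef_unitmx// -mulmxA -vN.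
Qed.
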